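(* Let $d\ge1$ and let $f(\theta)=P(\theta)=\sum_{k=-d}^{d}a_k e^{ik\theta}$ be a trigonometric polynomial with $a_{-k}=\overline{a_k}$ for $-d\le k\le d$. If $|a_d|>1$, then for every rational $p/q$ with $q>\dfrac{1}{2\log_2|a_d|}$, \[ S_-\Big(\frac pq\Big)=\varnothing. \]
   Context: Rational numbers are written $p/q$ in lowest terms with $q\ge1$. For $0\le\theta<2\pi$ let $H_{p/q,\theta}$ be the discrete Schr\''odinger operator on $\ell^2(\mathbb{N})$, $\mathbb{N}=\{1,2,\dots\}$, $[H_{p/q,\theta}\psi](n)=\psi(n+1)+\psi(n-1)+f(2\pi\frac pq n+\theta)\psi(n)$, where formally $\psi(0)=0$. The potential is $q$-periodic, and $\sigma(p/q,\theta)$ denotes the essential spectrum of $H_{p/q,\theta}$ (i.e. the spectrum of the half-line operator without its possible simple eigenvalues). Equivalently, $\sigma(p/q,\theta)=\{E\in\mathbb{R} : |\mathrm{tr}(T_q\cdots T_2T_1)|\le2\}$, where $T_n=\begin{pmatrix}E-f(2\pi\frac pq n+\theta)&-1\\1&0\end{pmatrix}$. Finally, $S_-(p/q)=\bigcap_{0\le\theta<2\pi}\sigma(p/q,\theta)$. *)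

(* Defs.v *)
From HB Require Import structures.
From mathcomp Require Import all_boot all_order all_algebra.
From mathcomp Require Import complex.
From mathcomp Require Import all_classical all_reals all_analysis.
Set Implicit Arguments.
Unset Strict Implicit.
Unset Printing Implicit Defensive.
Import Order.TTheory GRing.Theory Num.Theory.

Local Open Scope classical_set_scope.
Local Open Scope ring_scope.
Local Open Scope complex_scope.

Definition expi (R : realType) (t : R) : R[i] := cos t +i* sin t.

(* The sum over -d <= k <= d, indexed by j = k + d. *)
Definition trigpoly (R : realType) (d : nat) (a : int -> R[i]) (t : R) : R[i] :=
  \sum_(j < (d + d).+1)
    a (j%:Z - d%:Z) * expi ((j%:Z - d%:Z)%:~R * t).

Definition log2 (R : realType) (x : R) : R := ln x / ln 2.

(* Vectors of l^2({1,2,...}) are the square-summable sequences over nat whose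
   entry at 0 vanishes, so that the boundary condition psi(0) = 0 is built in. *)
Definition l2normsq (R : realType) (psi : nat -> R[i]) : \bar R :=
  (\sum_(0 <= n <oo) ((Normc.normc (psi n) ^+ 2)%:E))%E.

Definition l2 (R : realType) : set (nat -> R[i]) :=
  [set psi | psi 0%N = 0 /\ (l2normsq psi < +oo)%E].

Definition l2norm (R : realType) (psi : nat -> R[i]) : R :=
  Num.sqrt (fine (l2normsq psi)).

Definition minus_scalar (R : realType) (A : (nat -> R[i]) -> nat -> R[i])
    (E : R) (psi : nat -> R[i]) (n : nat) : R[i] :=
  A psi n - E%:C * psi n.

(* E is in the resolvent set: A - E is a bijection of l^2 with bounded inverse.
   Only real E are considered: the operators of interest are bounded and
   self-adjoint, so their spectrum is real. *)
Definition resolvent_set (R : realType) (A : (nat -> R[i]) -> nat -> R[i])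
    : set R :=
  [set E | (forall phi, l2 phi ->
              exists! psi, l2 psi /\ minus_scalar A E psi = phi) /\
           (exists K : R, forall psi, l2 psi ->
              l2norm psi <= K * l2norm (minus_scalar A E psi))].

Definition spectrum (R : realType) (A : (nat -> R[i]) -> nat -> R[i]) : set R :=
  ~` resolvent_set A.

Definition eigenspace (R : realType) (A : (nat -> R[i]) -> nat -> R[i]) (E : R)
    : set (nat -> R[i]) :=
  [set psi | l2 psi /\ minus_scalar A E psi = (fun=> 0)].

Definition finite_dimensional (R : realType) (V : set (nat -> R[i])) : Prop :=
  exists (m : nat) (v : 'I_m -> nat -> R[i]), forall psi, V psi ->
    exists c : 'I_m -> R[i], forall n, psi n = \sum_(i < m) c i * v i n.

Definition discrete_spectrum (R : realType)
    (A : (nat -> R[i]) -> nat -> R[i]) : set R :=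
  [set E | [/\ exists2 psi, eigenspace A E psi & psi <> (fun=> 0),
               finite_dimensional (eigenspace A E)
             & exists2 e : R, 0 < e & forall E' : R,
                 0 < `|E' - E| < e -> ~ spectrum A E']].

Definition essential_spectrum (R : realType)
    (A : (nat -> R[i]) -> nat -> R[i]) : set R :=
  spectrum A `\` discrete_spectrum A.

(* The operator H_{p/q, theta}, with r = p/q. *)
Definition schrodinger (R : realType) (f : R -> R[i]) (r : rat) (theta : R)
    (psi : nat -> R[i]) (n : nat) : R[i] :=
  if n is m.+1 then
    psi n.+1 + psi m + f (2 * pi * ratr r * n%:R + theta) * psi n
  else 0.

Definition sigma (R : realType) (f : R -> R[i]) (r : rat) (theta : R) : set R :=
  essential_spectrum (schrodinger f r theta).

Definition S_minus (R : realType) (f : R -> R[i]) (r : rat) : set R :=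
  \bigcap_(theta in [set t : R | 0 <= t < 2 * pi]) sigma f r theta.

(* Main.v *)
(* Fix an energy E. The trace Delta(theta) of the monodromy matrix over one period
   is a real trigonometric polynomial in theta whose coefficients of frequency
   +-dq have modulus |a_d|^q. If |Delta| <= 2 everywhere, Bessel's inequality
   (over equally spaced points) would give 2 |a_d|^(2q) <= 4, against the
   hypothesis on q; so |Delta(theta)| > 2 for some theta. For this theta the
   difference equation has exponentially decaying and growing Floquet solutions.
   Either the Dirichlet solution grows, and the Green function built from the two
   inverts H - E on l^2, or it decays, and E is a simple eigenvalue; it is then
   isolated, as nearby energies are of the first kind. In both cases E is not in
   the essential spectrum. *)
Require Import Defs.
From HB Require Import structures.
From mathcomp Require Import all_boot all_order all_algebra.
From mathcomp Require Import complex.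
From mathcomp Require Import zify ring lra.
From mathcomp Require Import all_classical all_reals all_analysis.
Set Implicit Arguments.
Unset Strict Implicit.
Unset Printing Implicit Defensive.
Import Order.TTheory GRing.Theory Num.Theory.
Import numFieldNormedType.Exports.
Local Open Scope classical_set_scope.
Local Open Scope ring_scope.
Local Open Scope complex_scope.

(** * Second-order recurrences and Floquet solutions *)

(* [g] is 1 for the difference equation itself; other values occur only once the
   equation is homogenized into polynomials in [z = e^(i theta)]. *)
Definition recurs (K : comNzRingType) (b : nat -> K) (g : K) (y : nat -> K) :=
  forall n, y n.+2 = b n * y n.+1 - g * y n.

Fixpoint rec2 (K : comNzRingType) (b : nat -> K) (g y0 y1 : K) (n : nat)
    : K * K :=
  if n is m.+1 then
    let p := rec2 b g y0 y1 m in (p.2, b m * p.2 - g * p.1)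
  else (y0, y1).

Definition recsol (K : comNzRingType) (b : nat -> K) (g y0 y1 : K) n :=
  (rec2 b g y0 y1 n).1.

Arguments recsol : simpl never.

Lemma recsol0 (K : comNzRingType) (b : nat -> K) g y0 y1 :
  recsol b g y0 y1 0 = y0.
Proof. by []. Qed.

Lemma recsol1 (K : comNzRingType) (b : nat -> K) g y0 y1 :
  recsol b g y0 y1 1 = y1.
Proof. by []. Qed.

Lemma recsolP (K : comNzRingType) (b : nat -> K) g y0 y1 :
  recurs b g (recsol b g y0 y1).
Proof. by []. Qed.

Lemma recurs_ext (K : comNzRingType) (b : nat -> K) g y z :
  recurs b g y -> recurs b g z -> y 0%N = z 0%N -> y 1%N = z 1%N ->
  forall n, y n = z n.
Proof.
move=> yP zP e0 e1 n; suff [] : y n = z n /\ y n.+1 = z n.+1 by [].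
by elim: n => // n [IH1 IH2]; rewrite yP zP IH1 IH2.
Qed.

Lemma recurs_lin (K : comNzRingType) (b : nat -> K) g y z s t :
  recurs b g y -> recurs b g z -> recurs b g (fun n => s * y n + t * z n).
Proof. by move=> yP zP n; rewrite yP zP; ring. Qed.

Lemma recsol_decomp (K : comNzRingType) (b : nat -> K) g y : recurs b g y ->
  forall n, y n = y 0%N * recsol b g 1 0 n + y 1%N * recsol b g 0 1 n.
Proof.
move=> yP; apply: recurs_ext yP _ _ _; first exact/recurs_lin.
- by rewrite !recsol0; ring.
- by rewrite !recsol1; ring.
Qed.

(** One step of [recurs b g] multiplies the Wronskian by [g], which is 1 here. *)
Lemma wronskian_const (K : comNzRingType) (b : nat -> K) y z :
  recurs b 1 y -> recurs b 1 z ->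
  forall n, y n * z n.+1 - y n.+1 * z n = y 0%N * z 1%N - y 1%N * z 0%N.
Proof. by move=> yP zP; elim=> // n <-; rewrite yP zP; ring. Qed.

Lemma recurs_shift (K : comNzRingType) (b : nat -> K) g q y :
  (forall n, b (n + q)%N = b n) ->
  recurs b g y -> recurs b g (fun n => y (n + q)%N).
Proof. by move=> bq yP n; rewrite !addSn yP bq. Qed.

(** The shift of [y] by a period and [mu] times [y] solve the same recurrence, so agreement at two
    consecutive sites suffices. *)
Lemma floquet_quasiperiodic (K : comNzRingType) (b : nat -> K) g q y mu :
  (forall n, b (n + q)%N = b n) -> recurs b g y ->
  y q = mu * y 0%N -> y q.+1 = mu * y 1%N ->
  forall n, y (n + q)%N = mu * y n.
Proof.
move=> bq yP y0 y1; apply: (recurs_ext (recurs_shift bq yP)) => //.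
by move=> n; rewrite yP; ring.
Qed.

Lemma recsol_rmorph (K L : comNzRingType) (h : {rmorphism K -> L}) b g y0 y1 n :
  h (recsol b g y0 y1 n) = recsol (h \o b) (h g) (h y0) (h y1) n.
Proof.
have [] // : h (recsol b g y0 y1 n) = recsol (h \o b) (h g) (h y0) (h y1) n /\
   h (recsol b g y0 y1 n.+1) = recsol (h \o b) (h g) (h y0) (h y1) n.+1.
elim: n => // n [IH1 IH2]; split=> //.
by rewrite !recsolP rmorphB !rmorphM IH1 IH2.
Qed.

Lemma eq_recsol (K : comNzRingType) (b b' : nat -> K) g y0 y1 :
  b =1 b' -> recsol b g y0 y1 =1 recsol b' g y0 y1.
Proof.
move=> bb; apply: (@recurs_ext _ b' g); [|exact: recsolP|by []|by []].
by move=> n; rewrite -bb recsolP.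
Qed.

(* The trace of the monodromy matrix, whose columns are the initial data
   (y 1, y 0) = (1, 0) and (0, 1) transported over [q] sites. *)
Definition discriminant (K : comNzRingType) (b : nat -> K) (g : K) (q : nat) :=
  recsol b g 0 1 q.+1 + recsol b g 1 0 q.

Section Hyperbolic.
Variables (R : realType) (q : nat) (b : nat -> R).
Hypotheses (q0 : (0 < q)%N) (bq : forall n, b (n + q)%N = b n).
Local Notation v := (recsol b 1 0 1).
Local Notation c := (recsol b 1 1 0).

Lemma monodromy_det : v q.+1 * c q - c q.+1 * v q = 1.
Proof.
have := wronskian_const (@recsolP _ b 1 1 0) (@recsolP _ b 1 0 1) q.
by rewrite !recsol0 !recsol1 => H; rewrite mulrC H; ring.
Qed.

(** The modulus of [y n] divided by [lam ^+ n] has period [q], so the sum over one period bounds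
    it. *)
Lemma geometric_envelope (y : nat -> R) (mu lam : R) : 0 < lam ->
  lam ^+ q = `|mu| -> (forall n, y (n + q)%N = mu * y n) ->
  exists C, forall n, `|y n| <= C * lam ^+ n.
Proof.
move=> l0 lq yq.
exists (\sum_(i < q) `|y i| / lam ^+ i) => n.
rewrite -ler_pdivrMr ?exprn_gt0//.
have -> : `|y n| / lam ^+ n = `|y (n %% q)%N| / lam ^+ (n %% q)%N.
  rewrite {1 2}(divn_eq n q); elim: (n %/ q)%N => [//|k <-].
  rewrite mulSn -addnA addnC yq normrM exprD lq -lq.
  by field; rewrite !expf_neq0 ?gt_eqF.
have qn : (n %% q < q)%N by rewrite ltn_mod.
rewrite (bigD1 (Ordinal qn)) //= lerDl.
by apply: sumr_ge0 => i _; rewrite divr_ge0// exprn_ge0// ltW.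
Qed.

(** The data [(v q, mu - c q)] form an eigenvector of the monodromy matrix for the root [mu] of its
    characteristic polynomial, whose constant term is the determinant 1. *)
Lemma floquet_solution (mu : R) : v q != 0 ->
  mu ^+ 2 - discriminant b 1 q * mu + 1 = 0 ->
  exists y, [/\ recurs b 1 y, y 0%N = v q, y 1%N = mu - c q &
                forall n, y (n + q)%N = mu * y n].
Proof.
move=> vq mu2; have W := monodromy_det.
exists (recsol b 1 (v q) (mu - c q)); split=> //.
apply: (floquet_quasiperiodic bq (@recsolP _ _ _ _ _)).
  by rewrite (recsol_decomp (@recsolP _ b 1 _ _)) !recsol0 !recsol1; ring.
rewrite (recsol_decomp (@recsolP _ b 1 _ _)) !recsol0 !recsol1.
apply/eqP; rewrite -subr_eq0; apply/eqP.
transitivity (- (mu ^+ 2 - discriminant b 1 q * mu + 1)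
   - (v q.+1 * c q - c q.+1 * v q - 1)); last by rewrite mu2 W; ring.
by rewrite /discriminant; ring.
Qed.

End Hyperbolic.

(** * The Green function *)

(** Convexity of the square: [l * s + x] is the average of [s] and [x / (1 - l)] with weights [l]
    and [1 - l]. *)
Lemma sqr_contraction (R : realFieldType) (l s x y : R) : 0 < l < 1 ->
  0 <= y -> y <= l * s + x -> y ^+ 2 <= l * s ^+ 2 + x ^+ 2 / (1 - l).
Proof.
move=> /andP[l0 l1] y0 yle.
have l1' : 0 < 1 - l by rewrite subr_gt0.
apply: (@le_trans _ _ ((l * s + x) ^+ 2)).
  by rewrite ler_sqr ?nnegrE// (le_trans y0).
rewrite -subr_ge0.
have -> : l * s ^+ 2 + x ^+ 2 / (1 - l) - (l * s + x) ^+ 2 =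
    l / (1 - l) * (x - (1 - l) * s) ^+ 2.
  by field; rewrite gt_eqF.
by rewrite mulr_ge0 ?sqr_ge0// divr_ge0 ?ltW.
Qed.

(** Young's inequality for convolution with the kernel [l ^+ n], whose sum is [1 / (1 - l)], in
    recursive form. *)
Lemma forward_conv_bound (R : realFieldType) (l : R) (s x : nat -> R) :
  0 < l < 1 -> (forall n, 0 <= s n) -> s 0%N <= x 0%N ->
  (forall n, s n.+1 <= l * s n + x n.+1) ->
  forall N, \sum_(n < N) s n ^+ 2 <= (\sum_(n < N) x n ^+ 2) / (1 - l) ^+ 2.
Proof.
move=> ll s0 s0x sS [|N]; first by rewrite !big_ord0 mul0r.
have /andP[l0 l1] := ll; have l1' : 0 < 1 - l by rewrite subr_gt0.
(* The boundary term [l * s N ^+ 2] pays for the next step of the squared recursion. *)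
suff H : (1 - l) * (\sum_(n < N.+1) s n ^+ 2) + l * s N ^+ 2 <=
    (\sum_(n < N.+1) x n ^+ 2) / (1 - l).
  rewrite expr2 invfM mulrA ler_pdivlMr// mulrC (le_trans _ H)// lerDl.
  by rewrite mulr_ge0 ?sqr_ge0// ltW.
elim: N => [|N IH].
  rewrite !big_ord1 -mulrDl subrK mul1r ler_pdivlMr//.
  have xs : s 0%N ^+ 2 <= x 0%N ^+ 2.
    by rewrite ler_sqr ?nnegrE// (le_trans (s0 _) s0x).
  apply: le_trans xs; rewrite ler_piMr ?sqr_ge0//; lra.
rewrite big_ord_recr [in leRHS]big_ord_recr /= mulrDr mulrDl.
have := sqr_contraction ll (s0 N.+1) (sS N).
move: IH; lra.
Qed.

(** Mirror image of the forward bound: the recursion runs down from [t N = 0], and the induction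
    peels off the first site. *)
Lemma backward_conv_bound (R : realFieldType) (l : R) (N : nat) (t x : nat -> R) :
  0 < l < 1 -> (forall n, (n <= N)%N -> 0 <= t n) -> t N = 0 ->
  (forall n, (n < N)%N -> t n <= l * t n.+1 + x n) ->
  \sum_(n < N) t n ^+ 2 <= (\sum_(n < N) x n ^+ 2) / (1 - l) ^+ 2.
Proof.
move=> ll t0 tN tS.
have /andP[l0 l1] := ll; have l1' : 0 < 1 - l by rewrite subr_gt0.
suff H : (1 - l) * (\sum_(n < N) t n ^+ 2) + l * t 0%N ^+ 2 <=
    (\sum_(n < N) x n ^+ 2) / (1 - l).
  rewrite expr2 invfM mulrA ler_pdivlMr// mulrC (le_trans _ H)// lerDl.
  by rewrite mulr_ge0 ?sqr_ge0// ltW.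
elim: N t x t0 tN tS => [|N IH] t x t0 tN tS.
  by rewrite !big_ord0 tN expr0n /=; lra.
have := IH (t \o succn) (x \o succn) (fun n => t0 n.+1) tN (fun n => tS n.+1) => {}IH.
rewrite big_ord_recl [in leRHS]big_ord_recl /= mulrDr mulrDl.
have := sqr_contraction ll (t0 0%N isT) (tS 0%N isT).
by move: IH; rewrite /=; lra.
Qed.

Lemma sum_sqrD_le (R : realFieldType) (N : nat) (x y : nat -> R) :
  \sum_(n < N) (x n + y n) ^+ 2 <=
  2 * \sum_(n < N) x n ^+ 2 + 2 * \sum_(n < N) y n ^+ 2.
Proof.
rewrite !mulr_sumr -big_split/=; apply: ler_sum => i _.
by have := sqr_ge0 (x i - y i); nra.
Qed.

Lemma sum_sqr_le_scaled (R : realFieldType) (N : nat) (C : R) (x y : nat -> R) :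
  (forall n, (n < N)%N -> `|x n| <= C * y n) ->
  \sum_(n < N) x n ^+ 2 <= C ^+ 2 * \sum_(n < N) y n ^+ 2.
Proof.
move=> xy; rewrite mulr_sumr; apply: ler_sum => i _.
rewrite -exprMn -real_normK ?num_real// ler_sqr ?nnegrE//; first exact: xy.
exact: le_trans (xy _ _).
Qed.

(** A Fatou argument on a finite window, which lets tails be truncated at [N] before [N] goes to
    infinity. *)
Lemma sum_sqr_cvg_le (R : realType) (L : nat) (y : nat -> nat -> R)
    (z : nat -> R) (M : R) :
  (forall n, y N n @[N --> \oo] --> z n) ->
  (forall N, (L <= N)%N -> \sum_(n < L) y N n ^+ 2 <= M) ->
  \sum_(n < L) z n ^+ 2 <= M.
Proof.
move=> yz yM.
have H : \sum_(n < L) y N n ^+ 2 @[N --> \oo] --> \sum_(n < L) z n ^+ 2.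
  elim: L {yM} => [|L IH].
    under eq_fun do rewrite big_ord0; rewrite big_ord0; exact: cvg_cst.
  under eq_fun do rewrite big_ord_recr/=; rewrite big_ord_recr/=.
  by apply: cvgD IH _; rewrite expr2; under eq_fun do rewrite expr2; exact: cvgM.
rewrite -(cvg_lim _ H)//; apply: limr_le; first by apply/cvg_ex; eexists; exact: H.
by near=> N; apply: yM; near: N; exists L.
Unshelve. all: by end_near. Qed.

Lemma norm_le_sum_sqr (R : realFieldType) (x : nat -> R) (B : R) :
  (forall N, \sum_(n < N) x n ^+ 2 <= B) -> forall n, `|x n| <= B + 1.
Proof.
move=> xB n; have := xB n.+1; rewrite big_ord_recr /=.
have : 0 <= \sum_(i < n) x i ^+ 2 by apply: sumr_ge0 => i _; exact: sqr_ge0.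
have := real_normK (num_real (x n)).
by have := sqr_ge0 (`|x n| - 1); nra.
Qed.

Section Green.
Variables (R : realType) (b u v : nat -> R) (C l : R).
Hypotheses (l01 : 0 < l < 1) (uP : recurs b 1 u) (vP : recurs b 1 v).
Hypotheses (v0 : v 0%N = 0) (v1 : v 1%N = 1) (u0 : u 0%N != 0).
Hypotheses (uC : forall n, `|u n| <= C * l ^+ n).
Hypotheses (vC : forall n, `|v n| <= C * l ^- n).

Let l0 : 0 < l. Proof. by case/andP: l01. Qed.

Let C0 : 0 <= C.
Proof. by have := uC 0; rewrite expr0 mulr1; apply: le_trans. Qed.

Let A (phi : nat -> R) n := \sum_(m < n.+1) v m * phi m.
Let U (phi : nat -> R) n := \sum_(m < n.+1) u m * phi m.

Let tail_sum_le (phi : nat -> R) n m : (n <= m)%N ->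
  `|\sum_(i < m) u i * phi i - \sum_(i < n) u i * phi i| <=
  C * (\sum_(i < m) l ^+ i * `|phi i| - \sum_(i < n) l ^+ i * `|phi i|).
Proof.
move=> /subnKC <-; elim: (m - n)%N => [|k IH].
  by rewrite addn0 !subrr normr0 mulr0.
rewrite addnS !big_ord_recr/= ![_ + _ - _]addrAC (le_trans (ler_normD _ _))//.
rewrite mulrDr lerD// normrM mulrA ler_wpM2r//.
Qed.

Lemma green_U_cvg (phi : nat -> R) B : (forall N, \sum_(n < N) phi n ^+ 2 <= B) ->
  cvgn (U phi).
Proof.
move=> phiB.
have phiB1 n : `|phi n| <= B + 1 by exact: norm_le_sum_sqr.
have B0 : 0 <= B + 1 by apply: le_trans (phiB1 0%N).
have H : cvgn (series (fun m => u m * phi m)).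
  apply: normed_cvg; apply: (@series_le_cvg _ _ (geometric (C * (B + 1)) l)).
  - by move=> n; exact: normr_ge0.
  - by move=> n; rewrite /geometric/= !mulr_ge0// exprn_ge0// ltW.
  - by move=> n; rewrite /geometric/= normrM mulrAC ler_pM.
  - apply: is_cvg_geometric_series; rewrite ger0_norm ?(ltW l0)//.
    by case/andP: l01.
have -> : U phi = (fun n => series (fun m => u m * phi m) (n + 1)%N).
  by apply: funext => n; rewrite /U /series/= addn1 big_mkord.
by move/cvg_ex: H => [x Hx]; apply/cvg_ex; exists x; rewrite cvg_shiftn.
Qed.

(** Split at the diagonal, the Green kernel is dominated by two geometric convolutions, which are
    bounded on l^2. The constant [K] is independent of [phi], as a resolvent bound requires. *)
Lemma green_solution : exists2 K : R, 0 <= K &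
  forall (phi : nat -> R) B, (forall N, \sum_(n < N) phi n ^+ 2 <= B) ->
  exists psi : nat -> R, [/\ psi 0%N = 0,
    forall n, psi n.+2 + psi n - b n * psi n.+1 = phi n.+1 &
    forall N, \sum_(n < N) psi n ^+ 2 <= K * B].
Proof.
have /andP[_ l1] := l01; have l1' : 0 < 1 - l by rewrite subr_gt0.
(* The factor 4 counts the two halves of the kernel, each doubled when their sum is squared. *)
pose K := 4 * (C ^+ 2 / `|u 0%N|) ^+ 2 / (1 - l) ^+ 2.
have K0 : 0 <= K by apply: divr_ge0; rewrite ?sqr_ge0// mulr_ge0 ?sqr_ge0.
exists K => // phi B phiB.
pose S := lim (U phi @ \oo).
have US : U phi N @[N --> \oo] --> S := green_U_cvg phiB.
(* The Green function [u (max m n) * v (min m n) / W], with Wronskian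
   [W = u 0], applied to [phi]; the minus sign is the orientation of [W]. *)
pose psi n := - (u n * A phi n + v n * (S - U phi n)) / u 0%N.
exists psi; split.
- by rewrite /psi v0 mul0r addr0 /A big_ord1 v0 mul0r mulr0 oppr0 mul0r.
- move=> n; have := wronskian_const uP vP n; rewrite v0 v1 mulr0 subr0 mulr1 => W.
  have -> : psi n.+2 + psi n - b n * psi n.+1 =
     (u n * v n.+1 - u n.+1 * v n) * phi n.+1 / u 0%N.
    rewrite /psi /A /U 4!big_ord_recr/= uP vP.
    by rewrite ![\sum_(i < n.+2) _]big_ord_recr/= ; field.
  by rewrite W mulrAC mulfV// mul1r.
move=> L.
(* Replacing the limit [S] by [U phi N] gives a backward sum that vanishes at [n = N], as the
   backward bound demands. *)
pose psiN N n := - (u n * A phi n + v n * (U phi N - U phi n)) / u 0%N.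
apply: (@sum_sqr_cvg_le _ _ psiN psi).
  move=> n; apply: cvgM; last exact: cvg_cst.
  apply: cvgN; apply: cvgD; first exact: cvg_cst.
  apply: cvgM; first exact: cvg_cst.
  by apply: cvgB => //; exact: cvg_cst.
move=> N LN.
(* Up to the factor [C ^+ 2], [s] and [t] majorize the two halves of the kernel: [u n] becomes
   [l ^+ n], [v n] becomes [l ^- n], and [phi] its modulus. *)
pose s n := l ^+ n * \sum_(m < n.+1) l ^- m * `|phi m|.
pose P n := \sum_(m < n.+1) l ^+ m * `|phi m|.
pose t n := l ^- n * (P N - P n).
have ln0 n : 0 <= l ^+ n by rewrite exprn_ge0// ltW.
have ln0' n : 0 <= l ^- n by rewrite invr_ge0.
have s0 n : 0 <= s n.
  by rewrite /s mulr_ge0// sumr_ge0// => i _; rewrite mulr_ge0.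
have t0 n : (n <= N)%N -> 0 <= t n.
  move=> nN; rewrite /t mulr_ge0// subr_ge0 /P -(subnKC nN).
  elim: (N - n)%N => [|k IH]; first by rewrite addn0.
  by rewrite addnS [leRHS]big_ord_recr/= (le_trans IH)// lerDl mulr_ge0.
have sb N' : \sum_(n < N') s n ^+ 2 <= B / (1 - l) ^+ 2.
  apply: le_trans
    (@forward_conv_bound _ l s (fun n => `|phi n|) l01 s0 _ _ _) _.
  - by rewrite /s big_ord1 expr0 invr1 !mul1r.
  - move=> n; rewrite /s big_ord_recr/= mulrDr exprS !mulrA lerD2l.
    by rewrite -exprS mulfV ?mul1r// expf_neq0// gt_eqF.
  - rewrite ler_wpM2r ?invr_ge0 ?sqr_ge0//.
    by under eq_bigr do rewrite real_normK ?num_real//.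
have tb : \sum_(n < N) t n ^+ 2 <= B / (1 - l) ^+ 2.
  apply: le_trans
    (@backward_conv_bound _ l N t (fun n => `|phi n.+1|) l01 t0 _ _) _.
  - by rewrite /t subrr mulr0.
  - move=> n nN; rewrite /t /P [\sum_(m < n.+2) _]big_ord_recr/=.
    set p := \sum_(m < _) _; set p' := \sum_(m < _) _.
    (* The exact source of this recursion is [l] times the modulus of [phi n.+1]; it is enlarged
       using [l < 1]. *)
    have -> : l * (l ^- n.+1 * (p - (p' + l ^+ n.+1 * `|phi n.+1|))) =
      l ^- n * (p - p') - l * `|phi n.+1|.
      by rewrite exprS; field; rewrite ?expf_neq0 ?gt_eqF.
    by have := mulr_ge0 (ltW l1') (normr_ge0 (phi n.+1)); lra.
  - rewrite ler_wpM2r ?invr_ge0 ?sqr_ge0//.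
    under eq_bigr do rewrite real_normK ?num_real//.
    apply: le_trans (phiB N.+1); rewrite big_ord_recl/= lerDr; exact: sqr_ge0.
have tbL : \sum_(n < L) t n ^+ 2 <= B / (1 - l) ^+ 2.
  apply: le_trans tb; rewrite -(subnKC LN) big_split_ord/= lerDl.
  by apply: sumr_ge0 => i _; exact: sqr_ge0.
have uA n : `|u n * A phi n| <= C ^+ 2 * s n.
  rewrite normrM expr2 mulrACA ler_pM//.
  rewrite /A mulr_sumr (le_trans (ler_norm_sum _ _ _))//; apply: ler_sum => i _.
  by rewrite normrM mulrA ler_wpM2r.
have vU n : (n < L)%N -> `|v n * (U phi N - U phi n)| <= C ^+ 2 * t n.
  move=> nL; rewrite normrM expr2 mulrACA ler_pM//.
  by apply: tail_sum_le; rewrite ltnS ltnW// (leq_trans nL).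
apply: (@le_trans _ _ ((C ^+ 2 / `|u 0%N|) ^+ 2 * \sum_(n < L) (s n + t n) ^+ 2)).
  apply: (@sum_sqr_le_scaled _ L _ (psiN N) (fun n => s n + t n)) => n nL.
  rewrite /psiN normrM normrN normfV mulrAC ler_wpM2r ?invr_ge0// [leRHS]mulrDr.
  by rewrite (le_trans (ler_normD _ _))// lerD ?uA ?vU.
have := sum_sqrD_le L s t => H.
have : \sum_(n < L) (s n + t n) ^+ 2 <= 4 * (B / (1 - l) ^+ 2).
  by have := sb L; move: H tbL; lra.
move=> /(ler_wpM2l (sqr_ge0 (C ^+ 2 / `|u 0%N|))) /le_trans; apply.
by rewrite /K le_eqVlt; apply/orP; left; apply/eqP; ring.
Qed.

(* A second solution [v] in l^2 would make the constant Wronskian tend to 0. *)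
Lemma green_unique (psi : nat -> R) B : recurs b 1 psi -> psi 0%N = 0 ->
  (forall N, \sum_(n < N) psi n ^+ 2 <= B) -> forall n, psi n = 0.
Proof.
move=> psiP psi0 psiB.
have psi_v n : psi n = psi 1%N * v n.
  have := recsol_decomp psiP n; rewrite psi0 mul0r add0r => ->.
  by congr (_ * _); rewrite [RHS](recsol_decomp vP) v0 v1 mul0r add0r mul1r.
suff psi1 : psi 1%N = 0 by move=> n; rewrite psi_v psi1 mul0r.
have W n : psi 1%N * u 0%N = u n * psi n.+1 - u n.+1 * psi n.
  by rewrite (wronskian_const uP psiP) psi0 mulr0 subr0 mulrC.
have psiB1 n : `|psi n| <= B + 1 by exact: norm_le_sum_sqr.
have u_cvg : u n @[n --> \oo] --> 0.
  apply/norm_cvg0P; apply: (@squeeze_cvgr _ _ _ _ (fun=> 0) (geometric C l)).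
  - by near=> n; rewrite normr_ge0 uC.
  - exact: cvg_cst.
  - by apply: cvg_geometric; rewrite ger0_norm ?(ltW l0)//; case/andP: l01.
have uS_cvg : u n.+1 @[n --> \oo] --> 0 by rewrite cvg_shiftS.
have B0 : 0 <= B + 1 by apply: le_trans (psiB1 0%N).
have /eqP : psi 1%N * u 0%N = 0.
  apply/eqP; rewrite -normr_eq0 eq_le normr_ge0 andbT.
  have Wn n : `|psi 1%N * u 0%N| <= (B + 1) * (`|u n| + `|u n.+1|).
    rewrite (W n) (le_trans (ler_normB _ _))// !normrM mulrDr lerD//.
    - by rewrite mulrC ler_wpM2r.
    - by rewrite mulrC ler_wpM2r.
  have H : (B + 1) * (`|u n| + `|u n.+1|) @[n --> \oo] --> 0.
    rewrite -(mulr0 (B + 1)).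
    apply: cvgM; first exact: cvg_cst.
    by rewrite -(addr0 (0 : R)); apply: cvgD; exact/norm_cvg0P.
  rewrite -(cvg_lim _ H)//; apply: limr_ge; first by apply/cvg_ex; eexists; exact: H.
  by near=> n; exact: Wn.
by rewrite mulf_eq0 (negPf u0) orbF => /eqP.
Unshelve. all: by end_near. Qed.
End Green.

(** * The resolvent of a half-line Jacobi operator *)

Definition jacobi (R : realType) (V : nat -> R) (psi : nat -> R[i]) (n : nat)
    : R[i] :=
  if n is m.+1 then psi n.+1 + psi m + (V n)%:C * psi n else 0.

(** As [v 0 = 0] and [v 1 = 1], the Wronskian of [u] and [v] is [u 0]. Sharing the rate [l] makes
    the Green kernel decay away from the diagonal. *)
Definition green_data (R : realType) (b : nat -> R) :=
  exists u v : nat -> R, exists C l : R,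
    [/\ 0 < l < 1, recurs b 1 u, recurs b 1 v &
    [/\ v 0%N = 0, v 1%N = 1, u 0%N != 0,
        forall n, `|u n| <= C * l ^+ n & forall n, `|v n| <= C * l ^- n]].

Section SquareSummable.
Variable R : realType.
Implicit Types (psi : nat -> R[i]).

Lemma sqr_normc (x : R[i]) : Normc.normc x ^+ 2 = complex.Re x ^+ 2 + complex.Im x ^+ 2.
Proof. by case: x => a b /=; rewrite sqr_sqrtr// addr_ge0// sqr_ge0. Qed.

Lemma sum_sqr_normc psi N : \sum_(n < N) Normc.normc (psi n) ^+ 2 =
  \sum_(n < N) complex.Re (psi n) ^+ 2 + \sum_(n < N) complex.Im (psi n) ^+ 2.
Proof. by rewrite -big_split; apply: eq_bigr => i _; rewrite sqr_normc. Qed.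

Lemma l2normsq_leP psi (B : R) : (l2normsq psi <= B%:E)%E <->
  forall N, \sum_(n < N) Normc.normc (psi n) ^+ 2 <= B.
Proof.
have psi0 n : (0 <= (Normc.normc (psi n) ^+ 2)%:E)%E by rewrite lee_fin sqr_ge0.
split=> [H N|H].
  rewrite -lee_fin; apply: le_trans H.
  rewrite -sumEFin -(big_mkord xpredT (fun n => (Normc.normc (psi n) ^+ 2)%:E)).
  exact: nneseries_lim_ge.
apply: lime_le; first by apply: is_cvg_nneseries.
by near=> N; rewrite big_mkord sumEFin lee_fin.
Unshelve. all: by end_near. Qed.

Lemma l2normsq_ge0 psi : (0 <= l2normsq psi)%E.
Proof. by apply: nneseries_ge0 => n _ _; rewrite lee_fin sqr_ge0. Qed.

Lemma l2P psi : l2 psi <-> psi 0%N = 0 /\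
  exists B, forall N, \sum_(n < N) Normc.normc (psi n) ^+ 2 <= B.
Proof.
split=> -[psi0 H]; split=> //.
  exists (fine (l2normsq psi)); apply/l2normsq_leP.
  by rewrite fineK// ge0_fin_numE// l2normsq_ge0.
by case: H => B /l2normsq_leP /le_lt_trans; apply; rewrite ltry.
Qed.

Lemma l2_fineK psi : l2 psi -> (fine (l2normsq psi))%:E = l2normsq psi.
Proof. by case=> _ H; rewrite fineK// ge0_fin_numE// l2normsq_ge0. Qed.

Lemma l2normsq_fine_sum psi : l2 psi ->
  forall N, \sum_(n < N) Normc.normc (psi n) ^+ 2 <= fine (l2normsq psi).
Proof. by move=> H; apply/l2normsq_leP; rewrite l2_fineK. Qed.

Lemma sum_sqr_Re_le psi (B : R) :
  (forall N, \sum_(n < N) Normc.normc (psi n) ^+ 2 <= B) ->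
  forall N, \sum_(n < N) complex.Re (psi n) ^+ 2 <= B.
Proof.
move=> H N; apply: le_trans (H N); rewrite sum_sqr_normc lerDl.
by apply: sumr_ge0 => i _; exact: sqr_ge0.
Qed.

Lemma sum_sqr_Im_le psi (B : R) :
  (forall N, \sum_(n < N) Normc.normc (psi n) ^+ 2 <= B) ->
  forall N, \sum_(n < N) complex.Im (psi n) ^+ 2 <= B.
Proof.
move=> H N; apply: le_trans (H N); rewrite sum_sqr_normc lerDr.
by apply: sumr_ge0 => i _; exact: sqr_ge0.
Qed.

End SquareSummable.

Section Resolvent.
Variables (R : realType) (V : nat -> R) (M E : R).
Hypothesis VM : forall n, `|V n| <= M.
Local Notation b := (fun n => E - V n.+1).
Local Notation H := (minus_scalar (jacobi V) E).
Implicit Types (psi : nat -> R[i]).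

Lemma Re_jacobi psi n : complex.Re (H psi n.+1) =
  complex.Re (psi n.+2) + complex.Re (psi n) - b n * complex.Re (psi n.+1).
Proof.
rewrite /minus_scalar /=; case: (psi n.+2) (psi n.+1) (psi n) => [? ?] [? ?] [? ?].
by rewrite /=; ring.
Qed.

Lemma Im_jacobi psi n : complex.Im (H psi n.+1) =
  complex.Im (psi n.+2) + complex.Im (psi n) - b n * complex.Im (psi n.+1).
Proof.
rewrite /minus_scalar /=; case: (psi n.+2) (psi n.+1) (psi n) => [? ?] [? ?] [? ?].
by rewrite /=; ring.
Qed.

Lemma complexP (x y : R[i]) :
  complex.Re x = complex.Re y -> complex.Im x = complex.Im y -> x = y.
Proof. by case: x y => [? ?] [? ?] /= -> ->. Qed.

(** A bounded potential gives a bounded operator; this makes [H psi] an admissible source in the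
    resolvent estimate. *)
Lemma l2_jacobi psi : l2 psi -> l2 (H psi).
Proof.
move=> /l2P[psi0 [B psiB]]; apply/l2P; split.
  by rewrite /minus_scalar /= psi0 mulr0 subr0.
have part (x y : nat -> R) : (forall N, \sum_(n < N) x n ^+ 2 <= B) ->
    y 0%N = 0 -> (forall n, y n.+1 = x n.+2 + x n - b n * x n.+1) ->
    forall N, \sum_(n < N) y n ^+ 2 <= 3 * (2 + (`|E| + M) ^+ 2) * B.
  move=> xB y0 yS N.
  have B0 : 0 <= B by have := xB 0%N; rewrite big_ord0.
  case: N => [|N]; first by rewrite big_ord0 !mulr_ge0// addr_ge0// sqr_ge0.
  rewrite big_ord_recl y0 expr0n/= add0r.
  apply: (@le_trans _ _ (3 * (\sum_(n < N) x n.+2 ^+ 2 + \sum_(n < N) x n ^+ 2 +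
      (`|E| + M) ^+ 2 * \sum_(n < N) x n.+1 ^+ 2))).
    rewrite (mulr_sumr _ _ _ ((`|E| + M) ^+ 2)) -!big_split/= mulr_sumr.
    apply: ler_sum => i _; rewrite /bump/= add1n yS.
    have bE : `|b i| <= `|E| + M by rewrite (le_trans (ler_normB _ _))// lerD2l.
    have b2 : b i ^+ 2 <= (`|E| + M) ^+ 2.
      by rewrite -real_normK ?num_real// ler_sqr ?nnegrE// (le_trans _ bE).
    have := ler_wpM2r (sqr_ge0 (x i.+1)) b2.
    move: (b i) => c {b2 bE}.
    have := sqr_ge0 (x i.+2 - x i); have := sqr_ge0 (x i.+2 + c * x i.+1).
    have := sqr_ge0 (x i + c * x i.+1).
    nra.
  have s1 : \sum_(n < N) x n.+1 ^+ 2 <= B.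
    by apply: le_trans (xB N.+1); rewrite big_ord_recl/= lerDr sqr_ge0.
  have s2 : \sum_(n < N) x n.+2 ^+ 2 <= B.
    apply: le_trans (xB N.+2); rewrite !big_ord_recl/= addrA lerDr.
    by rewrite addr_ge0 ?sqr_ge0.
  have := xB N; have := ler_wpM2l (sqr_ge0 (`|E| + M)) s1.
  by move: s2; lra.
exists (2 * (3 * (2 + (`|E| + M) ^+ 2) * B)) => N.
rewrite sum_sqr_normc mulr2n mulrDl mul1r lerD//.
- apply: (part (fun n => complex.Re (psi n)) (fun n => complex.Re (H psi n))).
  + exact: sum_sqr_Re_le.
  + by rewrite /minus_scalar /= psi0 mulr0 subr0.
  + by move=> n; rewrite Re_jacobi.
- apply: (part (fun n => complex.Im (psi n)) (fun n => complex.Im (H psi n))).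
  + exact: sum_sqr_Im_le.
  + by rewrite /minus_scalar /= psi0 mulr0 subr0.
  + by move=> n; rewrite Im_jacobi.
Qed.

(** The potential is real, so the Green function acts on real and imaginary parts separately.
    Uniqueness identifies every l^2 sequence with the Green solution for its own image, which bounds
    the inverse. *)
Lemma resolvent_jacobi : green_data b -> resolvent_set (jacobi V) E.
Proof.
move=> [u [v [C [l [l01 uP vP [v0 v1 u0 uC vC]]]]]].
have [K K0 solK] := green_solution l01 uP vP v0 v1 u0 uC vC.
have sol phi : l2 phi -> exists psi, [/\ l2 psi, H psi = phi &
    (l2normsq psi <= (2 * K * fine (l2normsq phi))%:E)%E].
  move=> phi2; have phiB := l2normsq_fine_sum phi2.
  have [x [x0 xS xB]] := solK (fun n => complex.Re (phi n)) _ (sum_sqr_Re_le phiB).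
  have [y [y0 yS yB]] := solK (fun n => complex.Im (phi n)) _ (sum_sqr_Im_le phiB).
  pose psi n : R[i] := x n +i* y n.
  have psiB N : \sum_(n < N) Normc.normc (psi n) ^+ 2 <= 2 * K * fine (l2normsq phi).
    by rewrite sum_sqr_normc; have := xB N; have := yB N; rewrite /=; lra.
  exists psi; split; last exact/l2normsq_leP.
    by apply/l2P; split; [rewrite /psi x0 y0 | exists (2 * K * fine (l2normsq phi))].
  apply: funext => -[|n].
    by case: phi2 => -> _; rewrite /minus_scalar/= /psi x0 y0 mulr0 subr0.
  by apply: complexP; rewrite ?Re_jacobi ?Im_jacobi ?xS ?yS.
have inj psi psi' : l2 psi -> l2 psi' -> H psi = H psi' -> psi = psi'.
  move=> /l2P[p0 [B pB]] /l2P[p0' [B' pB']] HH.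
  have part (x y : nat -> R) : (forall N, \sum_(n < N) x n ^+ 2 <= B) ->
      (forall N, \sum_(n < N) y n ^+ 2 <= B') -> x 0%N = 0 -> y 0%N = 0 ->
      (forall n, x n.+2 + x n - b n * x n.+1 = y n.+2 + y n - b n * y n.+1) ->
      forall n, x n = y n.
    move=> xB yB x0 y0 xy n; apply/eqP; rewrite -subr_eq0; apply/eqP.
    apply: (green_unique l01 uP vP v0 v1 u0 uC
      (psi := fun n => x n - y n) (B := 2 * B + 2 * B')).
    - move=> k; have := xy k; lra.
    - by rewrite x0 y0 subr0.
    - move=> N; have := sum_sqrD_le N x (fun n => - y n).
      under [X in _ <= _ + 2 * X -> _]eq_bigr do rewrite sqrrN.
      by have := xB N; have := yB N; rewrite /=; lra.
  apply: funext => n; apply: complexP.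
    apply: (part (fun n => complex.Re (psi n)) (fun n => complex.Re (psi' n))).
    - exact: sum_sqr_Re_le.
    - exact: sum_sqr_Re_le.
    - by rewrite p0.
    - by rewrite p0'.
    - by move=> k; rewrite -!Re_jacobi HH.
  apply: (part (fun n => complex.Im (psi n)) (fun n => complex.Im (psi' n))).
  - exact: sum_sqr_Im_le.
  - exact: sum_sqr_Im_le.
  - by rewrite p0.
  - by rewrite p0'.
  - by move=> k; rewrite -!Im_jacobi HH.
split.
  move=> phi /sol[psi [psi2 psiphi _]]; exists psi; split=> // psi' [psi2' psiphi'].
  by apply: inj => //; rewrite psiphi psiphi'.
exists (Num.sqrt (2 * K)) => psi psi2.
have [psi' [psi2' eqH bnd]] := sol _ (l2_jacobi psi2).
have -> : psi = psi' by exact: inj.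
rewrite eqH /l2norm -sqrtrM ?mulr_ge0// ler_wsqrtr//.
by rewrite -lee_fin l2_fineK.
Qed.

End Resolvent.

(** * Energies with hyperbolic monodromy *)

Section FloquetMultiplier.
Variable R : realType.

(** The roots have product 1 and the smaller one is taken; changing the sign of [mu] reduces to
    [D >= 0]. *)
Lemma floquet_multiplier (D : R) : 2 < `|D| ->
  exists mu : R, [/\ 0 < `|mu|, `|mu| < 1 & mu ^+ 2 - D * mu + 1 = 0].
Proof.
wlog D0 : D / 0 <= D => [wl|].
  have [/wl//|/ltW D0] := leP 0 D.
  rewrite -oppr_ge0 in D0; rewrite -normrN => /(wl _ D0) [mu [mu0 mu1 muE]].
  by exists (- mu); rewrite normrN; split=> //; rewrite -muE; ring.
rewrite ger0_norm// => D2; pose s := Num.sqrt (D ^+ 2 - 4).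
have s2 : s ^+ 2 = D ^+ 2 - 4 by rewrite sqr_sqrtr//; nra.
have s0 : 0 <= s by exact: sqrtr_ge0.
have sD : s < D by rewrite ltNge; apply/negP => ?; nra.
have Ds : D - 2 < s by rewrite ltNge; apply/negP => ?; nra.
exists ((D - s) / 2); rewrite ger0_norm; last lra.
split; [lra|lra|].
transitivity ((s ^+ 2 - (D ^+ 2 - 4)) / 4); first by field.
by rewrite s2 subrr mul0r.
Qed.

Lemma nat_root (q : nat) (x : R) : (0 < q)%N -> 0 < x -> x < 1 ->
  exists2 l : R, 0 < l < 1 & l ^+ q = x.
Proof.
move=> q0 x0 x1.
have e : (x `^ q%:R^-1) ^+ q = x.
  rewrite -powR_mulrn ?powR_ge0// -powRrM mulVf ?pnatr_eq0 -?lt0n//.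
  by rewrite powRr1// ltW.
exists (x `^ q%:R^-1) => //; rewrite powR_gt0//= ltNge; apply/negP.
by move=> /(exprn_ege1 q); rewrite e leNgt x1.
Qed.

End FloquetMultiplier.

Section HyperbolicGreen.
Variables (R : realType) (q : nat) (b : nat -> R).
Hypotheses (q0 : (0 < q)%N) (bq : forall n, b (n + q)%N = b n).
Local Notation v := (recsol b 1 0 1).
Local Notation c := (recsol b 1 1 0).

Lemma green_data_intro (u w : nat -> R) (C D l : R) : 0 < l < 1 ->
  recurs b 1 u -> recurs b 1 w -> w 0%N = 0 -> w 1%N = 1 -> u 0%N != 0 ->
  (forall n, `|u n| <= C * l ^+ n) -> (forall n, `|w n| <= D * l ^- n) ->
  green_data b.
Proof.
move=> l01 uP wP w0 w1 u0 uC wD; have /andP[/ltW l0 _] := l01.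
exists u, w, (`|C| + `|D|), l; split=> //; split=> // n.
- rewrite (le_trans (uC n))// ler_wpM2r ?exprn_ge0//.
  by rewrite (le_trans (ler_norm _))// lerDl.
- rewrite (le_trans (wD n))// ler_wpM2r ?invr_ge0 ?exprn_ge0//.
  by rewrite (le_trans (ler_norm _))// lerDr.
Qed.

(** The Floquet solutions for [mu] and its inverse both start from [v q], so their difference
    vanishes at 0; divided by [mu^-1 - mu] it is the Dirichlet solution. *)
Lemma hyperbolic_green : 2 < `|discriminant b 1 q| -> v q != 0 -> green_data b.
Proof.
move=> /floquet_multiplier[mu [mu0 mu1 muE]] vq.
have mun0 : mu != 0 by rewrite -normr_gt0.
have [l l01 lq] := nat_root q0 mu0 mu1; have /andP[l0 l1] := l01.
have muE' : mu^-1 ^+ 2 - discriminant b 1 q * mu^-1 + 1 = 0.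
  transitivity ((mu ^+ 2 - discriminant b 1 q * mu + 1) / mu ^+ 2); first by field.
  by rewrite muE mul0r.
have [u [uP u0 u1 uq]] := floquet_solution bq vq muE.
have [w [wP w0 w1 wq]] := floquet_solution bq vq muE'.
have [C uC] := geometric_envelope q0 l0 lq uq.
have lq' : l^-1 ^+ q = `|mu^-1| by rewrite exprVn lq normfV.
have li0 : 0 < l^-1 by rewrite invr_gt0.
have [D wD] := geometric_envelope q0 li0 lq' wq.
pose k := mu^-1 - mu.
have k0 : k != 0.
  rewrite subr_eq0; apply/negP => /eqP e.
  have := mu1; rewrite -(ltf_pV2 (x := 1)) ?posrE// invr1 -normfV e.
  by move=> /(lt_trans mu1); rewrite ltxx.
have ub : u 0%N != 0 by rewrite u0.
apply: (green_data_intro (u := u) (w := fun n => k^-1 * w n + (- k^-1) * u n)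
   (C := C) (D := `|k^-1| * (D + C)) (l := l)) => //.
- exact: recurs_lin.
- by rewrite u0 w0; ring.
- rewrite mulNr -mulrBr u1 w1.
  have -> : mu^-1 - c q - (mu - c q) = k by rewrite /k; ring.
  by rewrite mulVf.
move=> n; rewrite mulNr -mulrBr normrM -mulrA ler_wpM2l//.
rewrite (le_trans (ler_normB _ _))// mulrDl lerD//.
  by have := wD n; rewrite exprVn.
have C0 : 0 <= C by have := uC 0; rewrite expr0 mulr1; apply: le_trans.
rewrite (le_trans (uC n))// ler_wpM2l//.
apply: (@le_trans _ _ 1); first by rewrite exprn_ile1// ltW.
by rewrite -exprVn exprn_ege1// -invr1 lef_pV2 ?posrE// ltW.
Qed.

Lemma vanishing_quasiperiodic : v q = 0 -> forall n, v (n + q)%N = v q.+1 * v n.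
Proof.
move=> vq; apply: (floquet_quasiperiodic bq (@recsolP _ _ _ _ _)).
  by rewrite vq recsol0 mulr0.
by rewrite recsol1 mulr1.
Qed.

(** With [v q = 0] the monodromy matrix is triangular with eigenvalues [v q.+1] and [c q], inverse
    to each other; the Dirichlet solution is itself the growing Floquet solution. *)
Lemma vanishing_growing_green : v q = 0 -> 1 < `|v q.+1| -> green_data b.
Proof.
move=> vq v1; have W := monodromy_det q b; rewrite vq mulr0 subr0 in W.
have vn0 : v q.+1 != 0 by rewrite -normr_gt0 (lt_trans ltr01).
have cE : c q = (v q.+1)^-1 by apply: (mulfI vn0); rewrite W mulfV.
have c1 : `|c q| < 1 by rewrite cE normfV invf_lt1// (lt_trans ltr01).
have c0 : 0 < `|c q| by rewrite cE normr_gt0 invr_eq0.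
have vc : v q.+1 - c q != 0.
  by rewrite subr_eq0; apply/negP => /eqP e; move: (lt_trans c1 v1); rewrite e ltxx.
have [l l01 lq] := nat_root q0 c0 c1; have /andP[l0 l1] := l01.
(* The value at 1 makes the initial data an eigenvector for the contracting multiplier [c q]. *)
pose u := recsol b 1 1 (- c q.+1 / (v q.+1 - c q)).
have uP : recurs b 1 u by exact: recsolP.
have u0 : u 0%N = 1 by [].
have u1 : u 1%N = - c q.+1 / (v q.+1 - c q) by [].
have uq : forall n, u (n + q)%N = c q * u n.
  apply: (floquet_quasiperiodic bq uP);
    rewrite (recsol_decomp uP) u0 u1.
    by rewrite vq; ring.
  by field.
have [C uC] := geometric_envelope q0 l0 lq uq.
have lq' : l^-1 ^+ q = `|v q.+1| by rewrite exprVn lq cE normfV invrK.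
have li0 : 0 < l^-1 by rewrite invr_gt0.
have [D vD] := geometric_envelope q0 li0 lq' (vanishing_quasiperiodic vq).
apply: (green_data_intro (u := u) (w := v) (C := C) (D := D) (l := l)) => //.
- exact: oner_neq0.
- by move=> n; rewrite -exprVn.
Qed.

Lemma vanishing_decaying_l2 : v q = 0 -> `|v q.+1| < 1 ->
  exists B, forall N, \sum_(n < N) v n ^+ 2 <= B.
Proof.
move=> vq v1; have W := monodromy_det q b; rewrite vq mulr0 subr0 in W.
have v0 : 0 < `|v q.+1|.
  rewrite normr_gt0; apply/negP => /eqP e.
  by move: W; rewrite e mul0r => /esym/eqP; rewrite oner_eq0.
have [l l01 lq] := nat_root q0 v0 v1; have /andP[l0 l1] := l01.
have [C vC] := geometric_envelope q0 l0 lq (vanishing_quasiperiodic vq).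
have l2 : 0 < 1 - l ^+ 2 by nra.
exists (C ^+ 2 * (1 / (1 - l ^+ 2))) => N.
apply: le_trans (sum_sqr_le_scaled (y := fun n => l ^+ n) (fun n _ => vC n)) _.
rewrite ler_wpM2l ?sqr_ge0// ler_pdivlMr//.
suff -> : (\sum_(n < N) (l ^+ n) ^+ 2) * (1 - l ^+ 2) = 1 - l ^+ (2 * N).
  by rewrite lerBlDr lerDl exprn_ge0// ltW.
elim: N => [|N IH]; first by rewrite big_ord0 muln0 expr0; ring.
by rewrite big_ord_recr/= mulrDl IH mulnS exprD -exprM mulnC; ring.
Qed.

(** Otherwise [c q], the inverse of [v q.+1], would also have modulus 1 and the trace modulus at
    most 2. *)
Lemma vanishing_multiplier_neq1 : 2 < `|discriminant b 1 q| -> v q = 0 ->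
  `|v q.+1| != 1.
Proof.
move=> D2 vq; have W := monodromy_det q b; rewrite vq mulr0 subr0 in W.
apply/negP => /eqP v1.
have c1 : `|c q| = 1 by have := congr1 Num.norm W; rewrite normrM v1 mul1r normr1.
by have := lt_le_trans D2 (ler_normD _ _); rewrite v1 c1 ltxx.
Qed.

End HyperbolicGreen.

(** * Polynomial dependence on the energy *)

Section EnergyPolynomials.
Variables (R : realType) (V : nat -> R) (q : nat).
Hypothesis q0 : (0 < q)%N.
Local Notation b E := (fun n => E - V n.+1).

Let bp (n : nat) : {poly R} := 'X - (V n.+1)%:P.

Lemma recsol_energy_poly (y0 y1 E : R) n :
  (recsol bp 1 y0%:P y1%:P n).[E] = recsol (b E) 1 y0 y1 n.
Proof.
rewrite -[LHS]/(horner_eval E _) recsol_rmorph rmorph1 /= /horner_eval !hornerC.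
by apply: eq_recsol => m; rewrite /= /horner_eval /bp !hornerE.
Qed.

(** Each step multiplies by a polynomial of degree 1 and subtracts one of lower degree. Hence the
    Dirichlet solution at [q > 0] is a nonzero polynomial in the energy. *)
Lemma recsol_energy_size n :
  size (recsol bp 1 0%:P 1%:P n.+1) = n.+1 /\
  (size (recsol bp 1 0%:P 1%:P n) <= n)%N.
Proof.
elim: n => [|n [IH1 IH2]]; first by rewrite recsol0 recsol1 size_poly1 size_poly0.
split; last by rewrite IH1.
have p0 : recsol bp 1 0%:P 1%:P n.+1 != 0 by rewrite -size_poly_gt0 IH1.
have s : size (bp n * recsol bp 1 0%:P 1%:P n.+1) = n.+2.
  by rewrite size_mul ?polyXsubC_eq0// size_XsubC IH1.
rewrite recsolP mul1r size_polyDl s// size_polyN.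
by rewrite (leq_ltn_trans IH2)// ltnS leqnSn.
Qed.

(** A possible zero at [E] is split off with its multiplicity; the cofactor is nonzero at [E], hence
    nearby. *)
Lemma near_nonvanishing (p : {poly R}) (E : R) : p != 0 ->
  exists2 e : R, 0 < e & forall x, 0 < `|x - E| < e -> p.[x] != 0.
Proof.
move=> p0; have [k [g gE ->]] := multiplicity_XsubC p E.
rewrite p0 /= in gE.
have /cvgr_neq0/(_ gE) : g.[x] @[x --> E] --> g.[E] by exact: continuous_horner.
move=> /nbhs_ballP[e e0 ge]; exists e => // x /andP[x0 xe].
rewrite hornerM mulf_neq0//.
  by apply: ge; rewrite /ball/= distrC.
by rewrite horner_exp !hornerE expf_neq0// -normr_gt0.
Qed.

(* [recsol (b x) 1 0 1 q] is a monic polynomial in [x], so the eigenvalues of the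
   half-line operator in the gaps are isolated. *)
Lemma near_hyperbolic (E : R) : 2 < `|discriminant (b E) 1 q| ->
  exists2 e : R, 0 < e & forall x, 0 < `|x - E| < e ->
    2 < `|discriminant (b x) 1 q| /\ recsol (b x) 1 0 1 q != 0.
Proof.
move=> D2.
pose D := recsol bp 1 0%:P 1%:P q.+1 + recsol bp 1 1%:P 0%:P q.
have DE x : D.[x] = discriminant (b x) 1 q.
  by rewrite /D hornerD !recsol_energy_poly.
have pq : recsol bp 1 0%:P 1%:P q != 0.
  by rewrite -size_poly_gt0; case: q q0 => // k _; case: (recsol_energy_size k) => ->.
have [e1 e10 v1] := near_nonvanishing E pq.
have Dc : `|D.[x]| @[x --> E] --> `|D.[E]|.
  by apply: cvg_norm; exact: continuous_horner.
rewrite -DE in D2.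
have : \forall x \near E, 2 < `|D.[x]| by exact: (cvgr_gt _ Dc _ D2).
move=> /nbhs_ballP[e2 e20 D2'].
exists (Num.min e1 e2); first by rewrite lt_min e10.
move=> x /andP[x0]; rewrite lt_min => /andP[xe1 xe2]; split.
  by rewrite -DE; apply: D2'; rewrite /ball/= distrC.
by rewrite -recsol_energy_poly v1// x0.
Qed.

End EnergyPolynomials.

(** * Exclusion from the essential spectrum *)

Section EssentialSpectrum.
Variables (R : realType) (V : nat -> R) (q : nat).
Hypotheses (q0 : (0 < q)%N) (Vq : forall n, V (n + q)%N = V n).
Local Notation b E := (fun n => E - V n.+1).

Lemma jacobi_kernel E (psi : nat -> R[i]) : psi 0%N = 0 ->
  minus_scalar (jacobi V) E psi = (fun=> 0) ->
  forall n, psi n = psi 1%N * (recsol (b E) 1 0 1 n)%:C.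
Proof.
move=> psi0 psiE n.
have psiP : recurs (fun n => (b E n)%:C) 1 psi.
  move=> m; have := congr1 (fun f => f m.+1) psiE; rewrite /minus_scalar/=.
  rewrite rmorphB /= => /eqP; rewrite subr_eq0 => /eqP H.
  by rewrite mulrBl -H; ring.
rewrite (recsol_decomp psiP) psi0 mul0r add0r; congr (_ * _).
by rewrite recsol_rmorph rmorph1 rmorph0.
Qed.

Lemma finite_dimensional_eigenspace_jacobi E :
  finite_dimensional (Defs.eigenspace (jacobi V) E).
Proof.
exists 1%N, (fun _ n => (recsol (b E) 1 0 1 n)%:C) => psi [[psi0 _] psiE].
by exists (fun=> psi 1%N) => n; rewrite big_ord1; exact: jacobi_kernel.
Qed.

Lemma not_essential_spectrum E : 2 < `|discriminant (b E) 1 q| ->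
  ~ essential_spectrum (jacobi V) E.
Proof.
move=> D2.
have bq x n : b x (n + q)%N = b x n by rewrite -addSn Vq.
have [M VM] : exists M, forall n, `|V n| <= M.
  (* With multiplier and rate both 1, the envelope bound says that a periodic sequence is
     bounded. *)
  have [||n|M H] := @geometric_envelope R q q0 V 1 1; rewrite ?ltr01 ?expr1n ?normr1//.
    by rewrite Vq mul1r.
  by exists M => n; have := H n; rewrite expr1n mulr1.
have res x : green_data (b x) -> resolvent_set (jacobi V) x.
  exact: resolvent_jacobi VM.
case=> spE; apply.
have [vq|vq] := eqVneq (recsol (b E) 1 0 1 q) 0; last first.
  by case: spE; apply: res; exact: (hyperbolic_green q0 (bq E)).
have [v1|v1|v1] := ltgtP `|recsol (b E) 1 0 1 q.+1| 1.
- have [B vB] := vanishing_decaying_l2 q0 (bq E) vq v1.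
  split.
  + exists (fun n => (recsol (b E) 1 0 1 n)%:C).
      split.
        apply/l2P; split; first by rewrite recsol0.
        exists B => N.
        rewrite (sum_sqr_normc (fun n => (recsol (b E) 1 0 1 n)%:C)) /=.
        under [X in _ + X <= _]eq_bigr do rewrite expr0n/=.
        rewrite big1_eq addr0; exact: vB.
      apply: funext => -[|n]; rewrite /minus_scalar/=.
        by rewrite recsol0 mulr0 subr0.
      by rewrite recsolP; apply: complexP => /=; ring.
    by move=> /(congr1 (fun f => complex.Re (f 1%N))) /= /eqP; rewrite oner_eq0.
  + exact: finite_dimensional_eigenspace_jacobi.
  (* Near [E], but not at [E], the Dirichlet solution is nonzero at [q] and the discriminant still
     exceeds 2, so these energies lie in the resolvent set. *)
  + have [e e0 He] := near_hyperbolic q0 D2.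
    exists e => // x /He[Dx vx] spx; case: spx; apply: res.
    exact: (hyperbolic_green q0 (bq x)).
- by case: spE; apply: res; exact: (vanishing_growing_green q0 (bq E)).
- by have := vanishing_multiplier_neq1 D2 vq; rewrite v1 eqxx.
Qed.

End EssentialSpectrum.

(** * Fourier coefficients on the roots of unity *)

Section UnitCircle.
Variable R : realType.
Implicit Types (x y t : R).

Lemma expiD x y : expi (x + y) = expi x * expi y.
Proof. by rewrite /expi cosD sinD; apply: complexP => /=; ring. Qed.

Lemma expi0 : expi (0 : R) = 1.
Proof. by rewrite /expi cos0 sin0. Qed.

Lemma expiMn x n : expi (n%:R * x) = expi x ^+ n.
Proof.
elim: n => [|n IH]; first by rewrite mul0r expi0 expr0.
by rewrite -natr1 mulrDl mul1r expiD IH exprSr.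
Qed.

Lemma conjc_expi x : conjc (expi x) = expi (- x).
Proof. by rewrite /expi cosN sinN. Qed.

Lemma normc_expi x : Normc.normc (expi x) = 1.
Proof. by rewrite /= cos2Dsin2 sqrtr1. Qed.

Lemma expi_2pi_int (m : int) : expi (2 * pi * m%:~R : R) = 1.
Proof.
have expi_nat n : expi (2 * pi * n%:R : R) = 1.
  rewrite mulrC expiMn [expi _]/expi mulr_natl cos2pi sin2pi.
  by rewrite (_ : 1 +i* 0 = 1)// expr1n.
case: m => n; first exact: expi_nat.
by rewrite NegzE mulrNz mulrN -conjc_expi expi_nat conjc1.
Qed.

(** By the half-angle formula [cos x = 1] forces [sin (x / 2) = 0], impossible for
    [0 < x / 2 < pi]. *)
Lemma expi_neq1 x : 0 < x < 2 * pi -> expi x != 1.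
Proof.
move=> /andP[x0 x2]; apply/negP => /eqP /(congr1 (@complex.Re R)) /= c1.
have s0 : 0 < sin (x / 2).
  apply: sin_gt0_pi; rewrite divr_gt0//=.
  by rewrite ltr_pdivrMr// mulrC.
have : cos (x / 2 + x / 2) = 1 by rewrite -splitr.
rewrite cosD -!expr2; have := cos2Dsin2 (x / 2); nra.
Qed.

Lemma sum_expi_roots (M k : nat) : (0 < k < M)%N ->
  \sum_(j < M) expi (2 * pi * j%:R / M%:R : R) ^+ k = 0.
Proof.
move=> /andP[k0 kM]; have M0 : (0 < M)%N by apply: leq_trans kM.
have M0' : 0 < M%:R :> R by rewrite ltr0n.
pose w : R[i] := expi (2 * pi * k%:R / M%:R).
have wj (j : 'I_M) : expi (2 * pi * j%:R / M%:R : R) ^+ k = w ^+ j.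
  by rewrite -!expiMn; congr expi; ring.
rewrite (eq_bigr _ (fun j _ => wj j)).
have w1 : w != 1.
  apply: expi_neq1; rewrite divr_gt0 ?mulr_gt0 ?pi_gt0 ?ltr0n//=.
  by rewrite ltr_pdivrMr// ltr_pM2l ?ltr_nat// mulr_gt0 ?pi_gt0.
have wM : w ^+ M = 1.
  rewrite -expiMn mulrC divfK ?gt_eqF//.
  exact: (expi_2pi_int k%:Z).
have /eqP := subrX1 w M; rewrite wM subrr eq_sym mulf_eq0 subr_eq0 (negPf w1).
by move/eqP.
Qed.

(** With at least [size Q] nodes no positive power aliases to frequency 0, so averaging extracts the
    constant term. *)
Lemma sum_horner_roots (Q : {poly R[i]}) (M : nat) : (0 < M)%N ->
  (size Q <= M)%N ->
  \sum_(j < M) Q.[expi (2 * pi * j%:R / M%:R)] = M%:R * Q.[0].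
Proof.
case: M => // M _ QM.
under eq_bigr do rewrite (horner_coef_wide _ QM).
rewrite exchange_big /= big_ord_recl/= [X in _ + X]big1 ?addr0.
  under eq_bigr do rewrite expr0 mulr1.
  by rewrite sumr_const card_ord -horner_coef0 mulr_natl.
move=> k _; rewrite -mulr_sumr sum_expi_roots ?mulr0//=.
by rewrite /bump/= add1n ltnS ltn_ord.
Qed.

Lemma Re_sum (I : Type) (r : seq I) (F : I -> R[i]) :
  complex.Re (\sum_(i <- r) F i) = \sum_(i <- r) complex.Re (F i).
Proof. by apply: (big_morph (@complex.Re R)) => // -[? ?] [? ?]. Qed.

Lemma Re_natM (n : nat) (x : R[i]) :
  complex.Re (n%:R * x) = n%:R * complex.Re x.
Proof.
rewrite !mulr_natl; elim: n => [//|n IH]; rewrite !mulrS -IH.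
by case: x {IH} (x *+ n) => [? ?] [? ?].
Qed.

(* Pair the real numbers [x j] with the projections [rho j] of the unit vectors
   [z j] onto the direction of [Q0]; the [rho j ^+ 2] average to 1/2, and
   [2 * `|rho| <= sqrt 2 * (rho ^+ 2 + 1 / 2)]. *)
Lemma fourier_coef_bound (M : nat) (x : 'I_M -> R) (z : 'I_M -> R[i])
    (Q0 : R[i]) : (0 < M)%N ->
  (forall j, Normc.normc (z j) = 1) -> (forall j, `|x j| <= 2) ->
  \sum_j z j ^+ 2 = 0 ->
  \sum_j z j * (x j)%:C = M%:R * Q0 -> Normc.normc Q0 ^+ 2 <= 2.
Proof.
move=> M0 z1 x2 z20 zx; have M0' : 0 < M%:R :> R by rewrite ltr0n.
set s := Normc.normc Q0.
have s0 : 0 <= s by rewrite /s; case: (Q0) => ? ?; exact: sqrtr_ge0.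
have [->|sn0] := eqVneq s 0; first by rewrite expr0n.
pose w : R[i] := conjc Q0 * (s^-1)%:C.
have ss : complex.Re Q0 ^+ 2 + complex.Im Q0 ^+ 2 = s ^+ 2 by rewrite -sqr_normc.
have w1 : Normc.normc w ^+ 2 = 1.
  rewrite sqr_normc /w; case: (Q0) ss => p r /= ss.
  transitivity ((p ^+ 2 + r ^+ 2) / s ^+ 2); first by field.
  by rewrite ss divff// expf_neq0.
have wQ : complex.Re (w * Q0) = s.
  rewrite /w; case: (Q0) ss => p r /= ss.
  transitivity ((p ^+ 2 + r ^+ 2) / s); first by field.
  by rewrite ss; field.
pose rho j := complex.Re (w * z j).
(* Double-angle formula for the unit number [w * z j]; the squares [z j ^+ 2] sum to 0 and drop out
   of the average. *)
have rho2 j : rho j ^+ 2 = (1 + complex.Re (w ^+ 2 * z j ^+ 2)) / 2.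
  have : complex.Re (w * z j) ^+ 2 + complex.Im (w * z j) ^+ 2 = 1.
    by rewrite -sqr_normc Normc.normcM exprMn w1 z1 expr1n mulr1.
  rewrite -exprMn /rho; case: (w * z j) => p r /= e.
  lra.
have srho2 : \sum_j rho j ^+ 2 = M%:R / 2.
  rewrite (eq_bigr _ (fun j _ => rho2 j)) -mulr_suml big_split/= -Re_sum.
  by rewrite -mulr_sumr z20 mulr0 addr0 sumr_const card_ord.
have sx : \sum_j x j * rho j = M%:R * s.
  rewrite -wQ; transitivity (complex.Re (w * (M%:R * Q0))).
    rewrite -zx mulr_sumr Re_sum; apply: eq_bigr => j _.
    by rewrite mulrA /rho; case: (w * z j) => p r /=; ring.
  by rewrite mulrCA Re_natM.
pose c : R := Num.sqrt 2.
have c2 : c ^+ 2 = 2 by rewrite sqr_sqrtr.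
have c0 : 0 <= c by exact: sqrtr_ge0.
have : M%:R * s <= \sum_j c * (rho j ^+ 2 + 2^-1).
  rewrite -sx; apply: ler_sum => j _.
  apply: (@le_trans _ _ (2 * `|rho j|)).
    by rewrite (le_trans (ler_norm _))// normrM ler_wpM2r.
  have := sqr_ge0 (c * `|rho j| - 1); have := real_normK (num_real (rho j)).
  move: (`|rho j|) => p <-; nra.
have -> : \sum_j c * (rho j ^+ 2 + 2^-1) = M%:R * c.
  rewrite -mulr_sumr big_split/= srho2 sumr_const card_ord -[2^-1 *+ M]mulr_natl.
  by field.
rewrite ler_pM2l// => sc.
by rewrite -c2 ler_sqr.
Qed.

End UnitCircle.

(** * The discriminant as a function of theta *)

Section DiscriminantAlgebra.
Variable K : comNzRingType.
Implicit Types (b : nat -> K).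

Lemma discriminant_rmorph (L : comNzRingType) (h : {rmorphism K -> L}) b g q :
  h (discriminant b g q) = discriminant (h \o b) (h g) q.
Proof. by rewrite rmorphD !recsol_rmorph rmorph0 rmorph1. Qed.

Lemma eq_discriminant b b' g q : b =1 b' ->
  discriminant b g q = discriminant b' g q.
Proof.
by move=> bb; rewrite /discriminant !(eq_recsol g _ _ bb).
Qed.

(** Gauge transformation: multiplying a solution by [w ^+ n] turns the coefficients [b] and 1 into
    [w * b] and [w ^+ 2]. *)
Lemma discriminant_scale b (w : K) q :
  discriminant (fun n => w * b n) (w ^+ 2) q = w ^+ q * discriminant b 1 q.
Proof.
have v_scale : forall n, recsol (fun n => w * b n) (w ^+ 2) 0 1 n =
    if n is m.+1 then w ^+ m * recsol b 1 0 1 n else 0.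
  apply: recurs_ext (@recsolP _ _ _ _ _) _ _ _ => //.
    by case=> [|n]; rewrite !recsolP ?recsol0 ?recsol1 ?exprS ?expr0; ring.
  by rewrite !recsol1 expr0 mul1r.
have c_scale : forall n, recsol (fun n => w * b n) (w ^+ 2) 1 0 n =
    w ^+ n * recsol b 1 1 0 n.
  apply: recurs_ext (@recsolP _ _ _ _ _) _ _ _.
  - by move=> n; rewrite recsolP !exprS; ring.
  - by rewrite !recsol0 mul1r.
  - by rewrite !recsol1 mulr0.
by rewrite /discriminant v_scale c_scale mulrDr.
Qed.

(** For [g = 0] the recurrence has order one; this is the homogenized discriminant at [z = 0]. *)
Lemma discriminant_g0 b q : discriminant b 0 q.+1 = \prod_(i < q.+1) b i.
Proof.
have c0 n : recsol b 0 1 0 n.+1 = 0.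
  by elim: n => [|n IH]; rewrite ?recsol1// recsolP IH; ring.
rewrite /discriminant c0 addr0; elim: q.+1 => [|n IH]; first by rewrite big_ord0.
by rewrite recsolP IH big_ord_recr/= mul0r subr0 mulrC.
Qed.

End DiscriminantAlgebra.

Section TrigonometricPotential.
Variables (R : realType) (d : nat) (a : int -> R[i]).
Hypothesis a_sym : forall k : int, - d%:Z <= k <= d%:Z -> a (- k) = conjc (a k).
Local Notation f := (trigpoly d a).

Lemma conjc_trigpoly t : conjc (f t) = f t.
Proof.
rewrite /trigpoly rmorph_sum (reindex_inj rev_ord_inj)/=; apply: eq_bigr => j _.
have jd : (j <= d + d)%N by rewrite -ltnS.
have -> : ((d + d).+1 - j.+1)%:Z - d%:Z = - (j%:Z - d%:Z) :> int.
  by rewrite subSS -subzn// PoszD; ring.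
rewrite rmorphM -[LHS]/(conjc _ * conjc _) conjc_expi a_sym ?conjcK.
  by congr (_ * expi _); rewrite mulrNz; ring.
by move: jd; lia.
Qed.

Lemma trigpoly_real t : f t = (complex.Re (f t))%:C.
Proof.
have := conjc_trigpoly t; case: (f t) => x y /= [yy].
by have -> : y = 0 by lra.
Qed.

Lemma trigpoly_periodic t (m : int) : f (t + 2 * pi * m%:~R) = f t.
Proof.
apply: eq_bigr => j _; rewrite mulrDr expiD.
have -> : (j%:Z - d%:Z)%:~R * (2 * pi * m%:~R) =
    2 * pi * ((j%:Z - d%:Z) * m)%:~R :> R by rewrite intrM; ring.
by rewrite expi_2pi_int mulr1.
Qed.

(* [z^d * f (t + x)] as a polynomial in [z = e^(i x)]. *)
Definition shifted_poly (t : R) : {poly R[i]} :=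
  \sum_(j < (d + d).+1) (a (j%:Z - d%:Z) * expi ((j%:Z - d%:Z)%:~R * t)) *: 'X^j.

Lemma horner_shifted_poly t x :
  (shifted_poly t).[expi x] = expi x ^+ d * f (t + x).
Proof.
rewrite /shifted_poly horner_sum mulr_sumr; apply: eq_bigr => j _.
rewrite hornerZ hornerXn mulrCA -mulrA; congr (_ * _).
rewrite -!expiMn -!expiD; congr expi.
by rewrite intrB; ring.
Qed.

Lemma shifted_poly_at0 t :
  (shifted_poly t).[0] = a (- d%:Z) * expi ((- d%:Z)%:~R * t).
Proof.
rewrite /shifted_poly horner_sum big_ord_recl/= big1.
  by rewrite hornerZ hornerXn expr0 addr0 mulr1 sub0r.
by move=> j _; rewrite hornerZ hornerXn /bump/= expr0n mulr0.
Qed.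

Variable (r : rat).
Local Notation q := `|denq r|%N.

(** The real part only changes the type, since the symmetry of [a] makes [f] real-valued. *)
Definition potential (theta : R) (n : nat) : R :=
  complex.Re (f (2 * pi * ratr r * n%:R + theta)).

Lemma denq_gt0N : (0 < q)%N.
Proof. by rewrite absz_gt0 denq_neq0. Qed.

Lemma denq_natr : q%:R = (denq r)%:~R :> R.
Proof. by rewrite -[in RHS](gez0_abs (denq_ge0 r)). Qed.

Lemma schrodinger_jacobi theta :
  schrodinger f r theta = jacobi (potential theta).
Proof.
apply: funext => psi; apply: funext => -[//|n].
by rewrite /schrodinger trigpoly_real.
Qed.

Lemma potential_periodic theta n : potential theta (n + q) = potential theta n.
Proof.
rewrite /potential -[in RHS](trigpoly_periodic _ (numq r)); congr (complex.Re (f _)).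
have q1 : (denq r)%:~R != 0 :> R by rewrite intr_eq0 denq_neq0.
by rewrite natrD denq_natr /ratr; field.
Qed.

Section FixedEnergy.
Variable E : R.
Local Notation Delta theta :=
  (discriminant (fun n => E - potential theta n.+1) 1 q).

(* [z^(d q)] times the discriminant, as a polynomial in [z = e^(i theta)]; its
   constant term is the Fourier coefficient of frequency [- d q]. *)
Definition discriminant_poly : {poly R[i]} :=
  discriminant (fun n => E%:C *: 'X^d - shifted_poly (2 * pi * ratr r * n.+1%:R))
    ('X^d ^+ 2) q.

(** The factor [z^d] at each site clears the negative frequencies; by the gauge transformation the
    [q] sites contribute [z^(d q)]. *)
Lemma horner_discriminant_poly x :
  discriminant_poly.[expi x] = expi x ^+ (d * q) * (Delta x)%:C.
Proof.
rewrite -[LHS]/(horner_eval (expi x) _) discriminant_rmorph.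
transitivity (discriminant (fun n => expi x ^+ d * (E - potential x n.+1)%:C)
    ((expi x ^+ d) ^+ 2) q).
  rewrite rmorphXn /= /horner_eval hornerXn; apply: eq_discriminant => n /=.
  rewrite hornerD hornerN hornerZ hornerXn horner_shifted_poly trigpoly_real.
  by rewrite -[complex.Re _]/(potential x n.+1) rmorphB /=; ring.
rewrite (discriminant_scale (fun n => (E - potential x n.+1)%:C)) exprM.
by rewrite -[RHS]/(_ * real_complex R _) discriminant_rmorph rmorph1.
Qed.

(** At [z = 0] both [g = z^(2 d)] and the energy term vanish, leaving a product of [q] factors, each
    [a (- d)] up to sign and phase. *)
Lemma normc_discriminant_poly0 : (0 < d)%N ->
  Normc.normc discriminant_poly.[0] = Normc.normc (a d%:Z) ^+ q.
Proof.
move=> d0; rewrite -[X in Normc.normc X]/(horner_eval 0 _) discriminant_rmorph.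
rewrite rmorphXn /= {2}/horner_eval hornerXn expr0n (gtn_eqF d0) expr0n/=.
have -> : Normc.normc (a d%:Z) = Normc.normc (a (- d%:Z)).
  rewrite a_sym; last by lia.
  by case: (a d%:Z) => x y /=; rewrite sqrrN.
have bE n : Normc.normc (horner_eval 0
    (E%:C *: 'X^d - shifted_poly (2 * pi * ratr r * n.+1%:R))) =
    Normc.normc (a (- d%:Z)).
  rewrite /horner_eval hornerD hornerN hornerZ hornerXn expr0n (gtn_eqF d0).
  rewrite mulr0 sub0r normcN shifted_poly_at0 Normc.normcM normc_expi.
  by rewrite mulr1.
case: q denq_gt0N => // k _; rewrite discriminant_g0.
elim: k.+1 => [|m IH]; first by rewrite big_ord0 Normc.normc1.
by rewrite big_ord_recr/= Normc.normcM IH bE exprSr.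
Qed.

Lemma large_discriminant : (0 < d)%N ->
  2 < (Normc.normc (a d%:Z) ^+ q) ^+ 2 ->
  exists2 theta, 0 <= theta < 2 * pi & 2 < `|Delta theta|.
Proof.
move=> d0 a2; apply: contrapT => no.
have small theta : 0 <= theta < 2 * pi -> `|Delta theta| <= 2.
  by move=> tt; rewrite leNgt; apply/negP => D2; apply: no; exists theta.
(* Enough nodes for two purposes: at least [size discriminant_poly] isolates the constant term, and
   more than [2 d q] makes the squares of the sampled exponentials sum to 0. *)
pose M := (size discriminant_poly + (d * q).*2).+1.
pose th (j : 'I_M) : R := 2 * pi * j%:R / M%:R.
have M0 : 0 < M%:R :> R by rewrite ltr0n.
have thP j : 0 <= th j < 2 * pi.
  rewrite /th divr_ge0 ?mulr_ge0 ?pi_ge0 ?ler0n//= ltr_pdivrMr//.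
  by rewrite ltr_pM2l ?ltr_nat// mulr_gt0 ?pi_gt0.
have := @fourier_coef_bound R M (fun j => Delta (th j))
  (fun j => expi (th j) ^+ (d * q)) discriminant_poly.[0].
rewrite normc_discriminant_poly0// leNgt a2 /= => bnd.
suff : false by []; apply: bnd => //.
- by move=> j; rewrite -expiMn normc_expi.
- by move=> j; apply: small; exact: thP.
- under eq_bigr do rewrite -exprM muln2.
  by apply: sum_expi_roots; rewrite double_gt0 muln_gt0 d0 denq_gt0N ltnS leq_addl.
- rewrite -sum_horner_roots//; last by rewrite leqW// leq_addr.
  by apply: eq_bigr => j _; rewrite horner_discriminant_poly.
Qed.

End FixedEnergy.
End TrigonometricPotential.

Theorem proposition5p2 (R : realType) (d : nat) (a : int -> R[i])
    (d_ge1 : (1 <= d)%N)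
    (a_sym : forall k : int, - d%:Z <= k <= d%:Z -> a (- k) = conjc (a k))
    (a_d_gt1 : 1 < Normc.normc (a d%:Z))
    (r : rat)
    (q_large : ((denq r)%:~R : R) > 1 / (2 * log2 (Normc.normc (a d%:Z)))) :
  S_minus (trigpoly d a) r = set0.
Proof.
(* Taking logarithms turns this into the hypothesis on [q]. *)
have a2 : 2 < (Normc.normc (a d%:Z) ^+ `|denq r|%N) ^+ 2.
  rewrite -exprM; set A := Normc.normc _ in a_d_gt1 q_large *.
  have A0 : 0 < A by exact: lt_trans a_d_gt1.
  have ln2 : 0 < ln (2 : R) by rewrite ln_gt0// ltr1n.
  have lnA : 0 < ln A by rewrite ln_gt0.
  rewrite -ltr_ln ?posrE ?exprn_gt0// lnXn//.
  rewrite -[ln A *+ _]mulr_natl natrM denq_natr.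
  have k0 : 0 < 2 * log2 A by rewrite mulr_gt0// divr_gt0.
  by move: q_large; rewrite ltr_pdivrMr// /log2 !mulrA ltr_pdivlMr// mul1r.
rewrite -subset0 => E SE.
have [theta theta2pi D2] := large_discriminant a_sym E d_ge1 a2.
have := SE theta theta2pi; rewrite /sigma (schrodinger_jacobi a_sym).
by move/(not_essential_spectrum (denq_gt0N r) (potential_periodic d a r theta) D2).
Qed.
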